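(* Let $\Delta$ be a boolean complex and $\Bbbk$ a field. Let $f_1,\dots,f_r\in\Bbbk[\operatorname{Sd}\Delta]$ be homogeneous with respect to shape, and let $\mathscr{G}:\Bbbk[\operatorname{Sd}\Delta]\to\Bbbk[\Delta]$ be the Garsia transfer. Then: (1) If $f_1,\dots,f_r$ generate $\Bbbk[\operatorname{Sd}\Delta]$ as a $\Bbbk[\Gamma]$-module, then $\mathscr{G}(f_1),\dots,\mathscr{G}(f_r)$ generate $\Bbbk[\Delta]$ as a $\Bbbk[\Theta]$-module. (2) If $f_1,\dots,f_r$ are $\Bbbk[\Gamma]$-linearly independent, then $\mathscr{G}(f_1),\dots,\mathscr{G}(f_r)$ are $\Bbbk[\Theta]$-linearly independent.
   Context: Boolean complexes. A boolean complex $\Delta$ is a finite regular CW complex in which every cell is a simplex with its standard CW structure, the attaching maps sending cells homeomorphically to cells. Its cells are called faces. $P(\Delta)$ is the poset of faces ($\alpha\preceq\beta$ iff $\alpha$ lies in the closure of $\beta$) and $\widehat P(\Delta)=P(\Delta)\cup\{\varnothing\}$ with $\varnothing$ an adjoined minimum. Combinatorially $\Delta$ amounts to the finite poset $\widehat P(\Delta)$, which has a minimum and in which every lower interval is a boolean lattice. $\operatorname{rk}(\alpha)=\dim\alpha+1$ is the rank in $\widehat P(\Delta)$. Put $n=\dim\Delta+1$. Rings. $\Bbbk[\Delta]$ is the quotient of $\Bbbk[x_\alpha:\alpha\in\widehat P(\Delta)]$ by the ideal generated by: $x_\varnothing-1$; $x_\alpha x_\beta$ for $\alpha,\beta$ with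 no common upper bound; and $x_\alpha x_\beta-x_{\alpha\wedge\beta}\sum_\gamma x_\gamma$ for $\alpha,\beta$ with a common upper bound, summing over all minimal common upper bounds $\gamma$. Also $\Bbbk[\operatorname{Sd}\Delta]=\Bbbk[y_\alpha:\alpha\in P(\Delta)]/(y_\alpha y_\beta:\alpha,\beta\text{ incomparable})$. In each ring, a standard monomial is a monomial in the generators indexed by $P(\Delta)$ supported on a chain of $P(\Delta)$; the standard monomials form a $\Bbbk$-basis of each ring. Shape. $\mathscr{P}_n$ is the monoid of partitions with at most $n$ parts under componentwise addition (zero-padding). $(1^j)$ denotes the partition with $j$ parts equal to $1$. In $\Bbbk[\operatorname{Sd}\Delta]$ the shape of a standard monomial $\prod_\alpha y_\alpha^{c_\alpha}$ is $\sum_\alpha c_\alpha(1^{\operatorname{rk}(\alpha)})\in\mathscr{P}_n$. An element of $\Bbbk[\operatorname{Sd}\Delta]$ is homogeneous with respect to shape if it is a $\Bbbk$-linear combination of standard monomials of a single shape. Parameters. $\theta_j=\sum_{\alpha\in P(\Delta),\operatorname{rk}(\alpha)=j}x_\alpha$ and $\gamma_j=\sum_{\alpha\in P(\Delta),\operatorname{rk}(\alpha)=j}y_\alpha$ for $j=1,\dots,n$; $\Bbbk[\Theta]=\Bbbk[\theta_1,\dots,\theta_n]\subset\Bbbk[\Delta]$ and $\Bbbk[\Gamma]=\Bbbk[\gamma_1,\dots,\gamma_n]\subset\Bbbk[\operatorname{Sd}\Delta]$. Garsia transfer. $\mathscr{G}:\Bbbk[\operatorname{Sd}\Delta]\to\Bbbk[\Delta]$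 is the $\Bbbk$-linear isomorphism sending each standard monomial $\prod_\alpha y_\alpha^{c_\alpha}$ to the standard monomial $\prod_\alpha x_\alpha^{c_\alpha}$. *)

(* Defs.v *)
From HB Require Import structures.
From mathcomp Require Import all_boot all_order all_algebra.
From mathcomp Require Import boolp mpoly.

Set Implicit Arguments.
Unset Strict Implicit.
Unset Printing Implicit Defensive.

Import Order.TTheory GRing.Theory.
Local Open Scope ring_scope.
Local Open Scope quotient_scope.

Section GeneratedIdeal.
Variables (A : comNzRingType) (S : A -> Prop).

Definition gen_ideal (x : A) : Prop :=
  exists n (c s : 'I_n -> A),
    (forall i, S (s i)) /\ x = \sum_(i < n) c i * s i.

Lemma gen_ideal_closed (x u v : A) :
  gen_ideal u -> gen_ideal v -> gen_ideal (x * u + v).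
Proof.
move=> [m [c [s [Ss ->]]]] [p [e [t [St ->]]]].
exists (m + p)%N.
exists (fun i => match split i with inl j => x * c j | inr j => e j end).
exists (fun i => match split i with inl j => s j | inr j => t j end).
split; first by move=> i; case: (split i).
rewrite big_split_ord /= mulr_sumr; congr (_ + _); apply: eq_bigr => i _.
  by case: split_ordP => j /eqP; rewrite ?(inj_eq (@lshift_inj _ _)) ?eq_lrshift //
    => /eqP ->; rewrite mulrA.
by case: split_ordP => j /eqP; rewrite ?(inj_eq (@rshift_inj _ _)) ?eq_rlshift //
    => /eqP ->.
Qed.

Lemma gen_ideal0 : gen_ideal 0.
Proof.
by exists 0%N, (fun=> 0), (fun=> 0); split; [case | rewrite big_ord0].
Qed.

Lemma gen_ideal_gen x : S x -> gen_ideal x.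
Proof.
move=> Sx; exists 1%N, (fun=> 1), (fun=> x).
by split=> //; rewrite big_ord1 mul1r.
Qed.

(* A ring morphism killing the generators shows that the ideal is proper.     *)
Lemma gen_ideal_idealr (B : nzRingType) (h : {rmorphism A -> B}) :
  (forall x, S x -> h x = 0) ->
  idealr_closed (fun x => `[< gen_ideal x >]).
Proof.
move=> hS; split; rewrite /in_mem /=.
- by apply/asboolP; exact: gen_ideal0.
- apply/asboolP=> -[n [c [s [Ss /(congr1 h)]]]].
  rewrite rmorph1 rmorph_sum big1 /= => [|i _]; last first.
    by rewrite rmorphM (hS _ (Ss i)) mulr0.
  by move/eqP; rewrite oner_eq0.
- move=> a u v /asboolP Iu /asboolP Iv.
  by apply/asboolP; exact: gen_ideal_closed.
Qed.

End GeneratedIdeal.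

Section QuotientAlgebra.
Variables (k : comNzRingType) (A : comAlgType k) (I : idealr A).
Local Notation Q := {ideal_quot I}.

Definition quot_scale (c : k) (x : Q) : Q := \pi_Q (c%:A) * x.

Lemma quot_scaleA a b x : quot_scale a (quot_scale b x) = quot_scale (a * b) x.
Proof. by rewrite /quot_scale mulrA -rmorphM -scalerAl mul1r scalerA. Qed.

Lemma quot_scale1 : left_id 1 quot_scale.
Proof. by move=> x; rewrite /quot_scale scale1r rmorph1 mul1r. Qed.

Lemma quot_scaleDr : right_distributive quot_scale +%R.
Proof. by move=> a x y; rewrite /quot_scale mulrDr. Qed.

Lemma quot_scaleDl x : {morph quot_scale^~ x : a b / a + b}.
Proof. by move=> a b; rewrite /quot_scale scalerDl rmorphD mulrDl. Qed.

HB.instance Definition _ := GRing.Zmodule_isLmodule.Build k Q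
  quot_scaleA quot_scale1 quot_scaleDr quot_scaleDl.

Lemma quot_scaleAl (a : k) (x y : Q) : a *: (x * y) = a *: x * y.
Proof. exact: mulrA. Qed.

HB.instance Definition _ := GRing.Lmodule_isLalgebra.Build k Q quot_scaleAl.
HB.instance Definition _ := GRing.Lalgebra_isComAlgebra.Build k Q.

Lemma pi_quot_scalable : scalable (\pi_Q : A -> Q).
Proof.
by move=> a x; rewrite -[in LHS](mul1r x) scalerAl rmorphM.
Qed.

End QuotientAlgebra.

(* P is the face poset of the complex with the empty face adjoined as \bot.   *)
Section Poset.
Variables (d : Order.disp_t) (P : finBPOrderType d).
Implicit Types (a b g m : P).

Definition boolean_complex : Prop :=
  forall a, exists (m : nat) (phi : P -> {set 'I_m}),
    {in [pred x | x <= a]%O &,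
       forall x y, (phi x \subset phi y) = (x <= y)%O} /\
    forall s : {set 'I_m}, exists2 x, (x <= a)%O & phi x = s.

Definition chain (C : {set P}) : bool :=
  [forall x in C, forall y in C, (x >=< y)%O].

(* Length of a longest chain from \bot to a: C lists its elements below a.    *)
Definition rk a : nat :=
  \max_(C : {set P} | chain C && [forall x in C, (x < a)%O]) #|C|.

(* dim Delta + 1                                                              *)
Definition rank_complex : nat := \max_(a : P) rk a.

Definition upper_bound a b g : bool := (a <= g)%O && (b <= g)%O.

Definition has_upper_bound a b : bool := [exists g, upper_bound a b g].

Definition min_upper_bound a b g : bool :=
  upper_bound a b g && [forall h, upper_bound a b h ==> ~~ (h < g)%O].

Definition is_meet a b m : bool :=
  [forall x, (x <= m)%O == (x <= a)%O && (x <= b)%O].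

Definition face : Type := {a : P | a != \bot%O}.

HB.instance Definition _ := SubFinite.on face.

End Poset.

Arguments rank_complex {d} P.
Arguments boolean_complex {d} P.

Section Rings.
Variables (d : Order.disp_t) (P : finBPOrderType d) (k : fieldType).
Implicit Types (a b g m : P) (u v : face P).

Definition polyD := {mpoly k[#|P|]}.
HB.instance Definition _ := GRing.ComAlgebra.on polyD.

Definition varD a : polyD := 'X_(enum_rank a).

Inductive relD : polyD -> Prop :=
| RelD_bot : relD (varD \bot%O - 1)
| RelD_unbounded a b : ~~ has_upper_bound a b -> relD (varD a * varD b)
| RelD_bounded a b m : has_upper_bound a b -> is_meet a b m ->
    relD (varD a * varD b - varD m * \sum_(g | min_upper_bound a b g) varD g).

Definition idealD : {pred polyD} := fun p => `[< gen_ideal relD p >].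

Lemma relD_eval p : relD p ->
  meval (fun i => (enum_val i == \bot%O :> P)%:R) p = 0 :> k.
Proof.
have evX a : meval (fun i => (enum_val i == \bot%O :> P)%:R) (varD a)
    = (a == \bot%O)%:R :> k by rewrite mevalXU enum_rankK.
case=> [|a b|a b m].
- by rewrite mevalB meval1 evX eqxx subrr.
- have [->|a0] := eqVneq a \bot%O.
    by case/negP; apply/existsP; exists b; rewrite /upper_bound le0x lexx.
  by rewrite mevalM !evX (negbTE a0) mul0r.
- move=> _ /forallP mP; rewrite mevalB !mevalM raddf_sum /= !evX.
  have m_le : (m <= a)%O && (m <= b)%O by rewrite -(eqP (mP m)) lexx.
  under eq_bigr do rewrite evX.
  have [a0|a0] := eqVneq a \bot%O; last first.
    rewrite mul0r big1 ?mulr0 ?subrr // => g /andP[/andP[ag _] _].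
    case: eqP ag => // ->; rewrite lex0 => /eqP ag.
    by rewrite ag eqxx in a0.
  have m0 : m = \bot%O.
    by apply/eqP; rewrite -lex0 -a0; case/andP: m_le.
  rewrite m0 eqxx !mul1r (bigD1 b) /=; last first.
    rewrite /min_upper_bound /upper_bound a0 le0x lexx /=.
    apply/forallP=> h; apply/implyP; rewrite le0x /= => bh.
    by rewrite le_gtF.
  rewrite big1 ?addr0 ?subrr // => g /andP[/andP[/andP[_ bg] /forallP gP] gb].
  have /implyP := gP b; rewrite /upper_bound a0 le0x lexx => /(_ isT).
  by rewrite lt_neqAle bg andbT eq_sym gb.
Qed.

Lemma idealD_closed : idealr_closed idealD.
Proof. exact: gen_ideal_idealr relD_eval. Qed.

HB.instance Definition _ := isIdealr.Build polyD idealD idealD_closed.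

Definition kD := {ideal_quot idealD}.
HB.instance Definition _ := GRing.ComAlgebra.on kD.

Definition xgen a : kD := \pi_{ideal_quot idealD} (varD a).

Definition polySd := {mpoly k[#|{: face P}|]}.
HB.instance Definition _ := GRing.ComAlgebra.on polySd.

Definition varSd u : polySd := 'X_(enum_rank u).

Inductive relSd : polySd -> Prop :=
| RelSd u v : ~~ (val u >=< val v)%O -> relSd (varSd u * varSd v).

Definition idealSd : {pred polySd} := fun p => `[< gen_ideal relSd p >].

Lemma relSd_eval p : relSd p -> meval (fun=> 0) p = 0 :> k.
Proof. by case=> u v _; rewrite mevalM !mevalXU mul0r. Qed.

Lemma idealSd_closed : idealr_closed idealSd.
Proof. exact: gen_ideal_idealr relSd_eval. Qed.

HB.instance Definition _ := isIdealr.Build polySd idealSd idealSd_closed.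

Definition kSd := {ideal_quot idealSd}.
HB.instance Definition _ := GRing.ComAlgebra.on kSd.

Definition ygen u : kSd := \pi_{ideal_quot idealSd} (varSd u).

End Rings.

Arguments idealD {d} P k _.
Arguments idealSd {d} P k _.
Arguments xgen {d P} k a.
Arguments ygen {d P} k u.

Section Monomials.
Variables (d : Order.disp_t) (P : finBPOrderType d) (k : fieldType).

(* Exponent vectors of monomials in generators indexed by P(Delta).           *)
Definition monom := 'X_{1..#|{: face P}|}.
Implicit Types (m : monom) (u : face P).

Definition expo m u : nat := m (enum_rank u).

Definition standard m : bool :=
  chain [set val u | u : face P & expo m u != 0%N].

Definition monom_eval (A : comNzRingType) (z : face P -> A) m : A :=
  \prod_u z u ^+ expo m u.

Definition xmon m : kD P k := monom_eval (fun u => xgen k (val u)) m.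
Definition ymon m : kSd P k := monom_eval (ygen k) m.

(* A partition with at most n parts is its zero-padded sequence of n parts.   *)
Definition ones (n j : nat) : {ffun 'I_n -> nat} :=
  [ffun i : 'I_n => nat_of_bool (i < j)%N].

Definition shape m : {ffun 'I_(rank_complex P) -> nat} :=
  \sum_u ones (rank_complex P) (rk (val u)) *+ expo m u.

Definition shape_homogeneous (f : kSd P k) : Prop :=
  exists (lam : {ffun 'I_(rank_complex P) -> nat}) (N : nat)
         (c : 'I_N -> k) (m : 'I_N -> monom),
    (forall i, standard (m i) /\ shape (m i) = lam) /\
    f = \sum_(i < N) c i *: ymon (m i).

Definition theta (j : nat) : kD P k :=
  \sum_(u : face P | rk (val u) == j) xgen k (val u).

Definition gamma (j : nat) : kSd P k :=
  \sum_(u : face P | rk (val u) == j) ygen k u.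

(* The subalgebra k[z_1, .., z_n] of A, with z indexed from 1.                *)
Definition subalg_gen (A : comAlgType k) (n : nat) (z : nat -> A) (a : A) :
    Prop :=
  exists p : {mpoly k[n]}, a = mmap (in_alg A) (fun i => z i.+1) p.

Definition kTheta : kD P k -> Prop := subalg_gen (rank_complex P) theta.
Definition kGamma : kSd P k -> Prop := subalg_gen (rank_complex P) gamma.

(* The k-linear map on polynomials which is y^m |-> x^m on standard monomials *)
(* and 0 on the others; it factors through k[Sd Delta], whose defining ideal  *)
(* is spanned by the nonstandard monomials.                                   *)
Definition garsia_poly (p : polySd P k) : kD P k :=
  \sum_(m <- msupp p | standard m) p@_m *: xmon m.

Definition garsia (f : kSd P k) : kD P k :=
  garsia_poly (repr (f : {ideal_quot (idealSd P k)})).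

Lemma garsia_polyE (s : seq monom) p : uniq s -> {subset msupp p <= s} ->
  garsia_poly p = \sum_(m <- s | standard m) p@_m *: xmon m.
Proof.
move=> us sub; rewrite /garsia_poly (bigID (fun m => m \in msupp p)) /=.
rewrite [RHS](bigID (fun m => m \in msupp p)) /=.
rewrite [X in _ + X]big_seq_cond [X in _ + X]big1 => [|m]; last first.
  by case/andP=> -> /andP[].
rewrite [X in _ = _ + X]big1 => [|m /andP[_ /memN_msupp_eq0 ->]]; last first.
  by rewrite scale0r.
rewrite !addr0 -[LHS]big_filter -[RHS]big_filter; apply: perm_big.
apply: uniq_perm; rewrite ?filter_uniq ?msupp_uniq // => m.
rewrite !mem_filter; case: (boolP (m \in msupp p)) => [/sub ->|_].
  by rewrite !andbT.
by rewrite !andbF.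
Qed.

Lemma garsia_poly_linear : linear garsia_poly.
Proof.
move=> c p q; pose s := undup (msupp p ++ msupp q ++ msupp (c *: p + q)).
have us : uniq s := undup_uniq _.
rewrite !(@garsia_polyE s) //; try by move=> m hm;
  rewrite mem_undup !mem_cat hm ?orbT.
rewrite scaler_sumr -big_split /=; apply: eq_bigr => m _.
by rewrite mcoeffD mcoeffZ scalerDl scalerA.
Qed.

HB.instance Definition _ := GRing.isLinear.Build k (polySd P k) (kD P k) _
  garsia_poly garsia_poly_linear.

Lemma garsia_polyX m :
  garsia_poly 'X_[m] = if standard m then xmon m else 0.
Proof.
by rewrite /garsia_poly msuppX big_mkcond big_seq1 mcoeffX eqxx scale1r.
Qed.

Lemma garsia_poly_ideal p : gen_ideal (@relSd d P k) p -> garsia_poly p = 0.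
Proof.
move=> [n [c [s [Ss ->]]]]; rewrite linear_sum big1 // => i _.
case: (Ss i) => u v uv; rewrite (mpolyE (c i)) mulr_suml linear_sum big1 //.
move=> m _; rewrite -scalerAl linearZ /= /varSd -!mpolyXD garsia_polyX.
case: ifP => [|_]; last by rewrite scaler0.
move=> /forallP/(_ (val u))/implyP.
rewrite imset_f ?inE; last first.
  by rewrite /expo !mnmDE mnm1E eqxx addnCA.
move=> /(_ isT) /forallP/(_ (val v))/implyP.
rewrite imset_f ?inE; last first.
  by rewrite /expo !mnmDE [X in (_ + (_ + X))%N]mnm1E eqxx !addnS.
by move=> /(_ isT) uv'; rewrite uv' in uv.
Qed.

Lemma garsia_pi p : garsia (\pi_{ideal_quot (idealSd P k)} p) = garsia_poly p.
Proof.
rewrite /garsia; apply/eqP; rewrite -subr_eq0 -linearB /=; apply/eqP.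
apply: garsia_poly_ideal; apply/asboolP.
have : (repr (\pi_{ideal_quot (idealSd P k)} p) - p) \in idealSd P k.
  by rewrite Quotient.idealrBE reprK.
by [].
Qed.

Lemma garsia_linear : linear garsia.
Proof.
move=> c f g; rewrite -[f]reprK -[g]reprK -pi_quot_scalable -rmorphD.
by rewrite !garsia_pi linearP.
Qed.

HB.instance Definition _ := GRing.isLinear.Build k (kSd P k) (kD P k) _
  garsia garsia_linear.

Lemma ymonE m : ymon m = \pi_{ideal_quot (idealSd P k)} 'X_[m].
Proof.
rewrite /ymon /monom_eval mpolyXE_id rmorph_prod (reindex enum_rank) /=.
  by apply: eq_bigr => u _; rewrite rmorphXn.
exact: (onW_bij _ (@enum_rank_bij _)).
Qed.

Lemma garsia_standard m : standard m -> garsia (ymon m) = xmon m.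
Proof. by move=> sm; rewrite ymonE garsia_pi garsia_polyX sm. Qed.

End Monomials.

(* a family f in A, seen as a module over the subring S of A                  *)
Definition generates (A : comNzRingType) (S : A -> Prop) (r : nat)
    (f : 'I_r -> A) : Prop :=
  forall q : A, exists a : 'I_r -> A,
    (forall i, S (a i)) /\ q = \sum_(i < r) a i * f i.

Definition lin_indep (A : comNzRingType) (S : A -> Prop) (r : nat)
    (f : 'I_r -> A) : Prop :=
  forall a : 'I_r -> A, (forall i, S (a i)) ->
    \sum_(i < r) a i * f i = 0 -> forall i, a i = 0.

Arguments kTheta {d} P k _.
Arguments kGamma {d} P k _.

(* Main.v *)
From HB Require Import structures.
From mathcomp Require Import all_boot all_order all_algebra.
From mathcomp Require Import boolp mpoly zify.
Require Import Defs.

Set Implicit Arguments.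
Unset Strict Implicit.
Unset Printing Implicit Defensive.

Import Order.TTheory GRing.Theory.
Local Open Scope quotient_scope.

(** The rings k[Delta] and k[Sd Delta] are both quotients of the polynomial ring
A on the nonempty faces, by [toD] and [toSd], and the transfer of [toSd F] is
[toD] of the standard part of F ([garsia_toSd]).  Take in A the sum of the
variables of rank j: it lifts theta_j as well as gamma_j.  So the
combination of the f_i with coefficients p_i(gamma) and that of their transfers
with coefficients p_i(theta) have a common lift H to A.  In
k[Sd Delta] the nonstandard part of H vanishes; in k[Delta] it is merely
negligible, because straightening a nonstandard monomial lowers its shape.

The decrease of the shape is measured by one integer, the [energy]: the sum of
the squares of the parts of the shape.  For a monomial with exponents c_u it is
the sum of c_u c_v min(rk u, rk v) over all pairs of faces.

Straightening lowers the energy: the relation replaces incomparable faces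
u, v by their meet and a minimal upper bound, whose ranks have the same sum but
are further apart ([energy_straighten]).

In the opposite direction, restrict to a simplex a: sending x_b to the product
of the vertices of b if b lies in a, and to 0 otherwise, defines a morphism from
k[Delta] to a polynomial ring ([local_var_rel]).  The squared norm of the
exponent vector of the image of a monomial is the sum of c_u c_v #|u :&: v|,
so it is at most the energy, with equality exactly for standard monomials
([leqif_weight]).  As distinct standard monomials on a have distinct images
([weight_inj]), in an element of the kernel of [toD] the standard monomials of
top energy have coefficient 0 ([leading_standard_eq0]).

Both parts follow by peeling off layers of constant energy, which the shape
homogeneity of the f_i makes compatible with combinations
([keep_combination]).  For independence, the top layer of a relation between
the transfers has no standard part, hence is a relation between the f_i, hence
is trivial because the gamma_j are algebraically independent.  For generation,
write a standard monomial of k[Sd Delta] in terms of the f_i and keep the layer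
of its energy: in k[Delta] the same identity holds up to nonstandard monomials
of that energy, and these are sums of monomials of smaller energy. *)

(** * Vertex sets of the faces of a simplex *)

Section Coordinates.
Variables (d : Order.disp_t) (P : finBPOrderType d).
Implicit Types (x y z b g : P).

(** The faces of the simplex a are identified with the sets of its vertices;
phi is arbitrary on the faces that do not lie in a. *)
Definition coordinates a m (phi : P -> {set 'I_m}) : Prop :=
  {in [pred x | x <= a]%O &, forall x y, (phi x \subset phi y) = (x <= y)%O} /\
  forall s : {set 'I_m}, exists2 x, (x <= a)%O & phi x = s.

Variables (a : P) (m : nat) (phi : P -> {set 'I_m}).
Hypothesis co : coordinates a phi.

Lemma coord_sub x y : (x <= a)%O -> (y <= a)%O ->
  (phi x \subset phi y) = (x <= y)%O.
Proof. by case: co => sub _ xa ya; apply: sub. Qed.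

Lemma coord_inj x y : (x <= a)%O -> (y <= a)%O -> phi x = phi y -> x = y.
Proof.
move=> xa ya e; apply/le_anti.
by rewrite -(coord_sub xa ya) -(coord_sub ya xa) e subxx.
Qed.

Lemma coord_bot : phi \bot%O = set0.
Proof.
have [x xa x0] := co.2 set0.
by apply/eqP; rewrite -subset0 -x0 coord_sub ?le0x.
Qed.

Lemma coord_top : phi a = setT.
Proof.
have [x xa xT] := co.2 setT.
by apply/eqP; rewrite -subTset -xT coord_sub.
Qed.

Lemma coord_surj : exists pre : {set 'I_m} -> P,
  forall s, (pre s <= a)%O /\ phi (pre s) = s.
Proof.
have [s|pre preP] :=
    @choice _ _ (fun (s : {set 'I_m}) x => (x <= a)%O /\ phi x = s).
  by have [x] := co.2 s; exists x.
by exists pre.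
Qed.

Lemma chain_coord_uniq (C : {set P}) :
  chain C -> {in C, forall x, (x <= a)%O} ->
  {in C &, injective (fun x => #|phi x|)}.
Proof.
move=> /forall_inP chC Ca x y xC yC /= e.
have /forall_inP/(_ _ yC) := chC _ xC.
wlog xy : x y xC yC e / (x <= y)%O.
  move=> th /orP[] xy; first by apply: th => //; rewrite /Order.comparable xy.
  by apply/esym; apply: th => //; rewrite /Order.comparable xy.
move=> _; apply: coord_inj; rewrite ?Ca //.
by apply/eqP; rewrite eqEcard coord_sub ?Ca // e leqnn andbT.
Qed.

(** Cardinality is injective on the vertex sets of a chain, which bounds the
length of chains below b; the initial segments of an enumeration of [phi b]
reach the bound. *)
Lemma rk_coord b : (b <= a)%O -> rk b = #|phi b|.
Proof.
move=> ba; apply/eqP; rewrite eqn_leq; apply/andP; split.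
  apply/bigmax_leqP => C /andP[chC /forall_inP Cb].
  have Ca x : x \in C -> (x <= a)%O by move/Cb/ltW/le_trans; apply.
  have inj := chain_coord_uniq chC Ca.
  rewrite cardE -(size_map (fun x => #|phi x|)) -[leqRHS](size_iota 0).
  apply: uniq_leq_size.
    by rewrite map_inj_in_uniq ?enum_uniq // => x y;
       rewrite !mem_enum; apply: inj.
  move=> n /mapP[x]; rewrite mem_enum => xC ->.
  have xb := Cb _ xC.
  rewrite mem_iota /= add0n; apply: proper_card.
  rewrite properE (coord_sub (Ca _ xC) ba) (coord_sub ba (Ca _ xC)).
  by rewrite (ltW xb) lt_geF.
have [pre preP] := coord_surj.
pose S j := [set i in take j (enum (phi b))].
have SE (j : 'I_#|phi b|) : #|S j| = j.
  rewrite cardsE (card_uniqP _) ?take_uniq ?enum_uniq // size_takel //.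
  by rewrite -cardE ltnW.
have Sinj : injective (fun j : 'I_#|phi b| => pre (S j)).
  move=> i j /(congr1 phi); rewrite !(preP _).2.
  move=> /(congr1 (fun s : {set _} => #|s|)).
  by rewrite !SE; apply: val_inj.
rewrite -[X in X <= _](card_ord #|phi b|) -(card_imset _ Sinj) /rk.
apply: (@leq_bigmax_cond _ _ (fun C : {set P} => #|C|)).
apply/andP; split; last first.
  apply/forall_inP => _ /imsetP[j _ ->].
  have [Sa SE'] := preP (S j).
  rewrite lt_leAnge -(coord_sub Sa ba) -(coord_sub ba Sa) SE' -properE.
  rewrite properEcard SE ltn_ord andbT.
  by apply/subsetP=> i; rewrite inE => /mem_take; rewrite mem_enum.
apply/forall_inP => _ /imsetP[i _ ->]; apply/forall_inP => _ /imsetP[j _ ->].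
have le (i' j' : 'I_#|phi b|) : (i' <= j')%N -> (pre (S i') <= pre (S j'))%O.
  move=> ij; rewrite -(coord_sub (preP _).1 (preP _).1) !(preP _).2.
  by apply/subsetP=> l; rewrite !inE -{1}(minn_idPl ij) take_min => /mem_take.
rewrite /Order.comparable.
by case/orP: (leq_total i j) => /le -> //; rewrite orbT.
Qed.

(** Two faces may have several minimal upper bounds, but only one inside each
simplex that contains both: every upper bound in a contains the union of the
vertex sets, and this union is itself the vertex set of a face of a. *)
Lemma coord_min_upper_bound x y g : (x <= a)%O -> (y <= a)%O -> (g <= a)%O ->
  min_upper_bound x y g = (phi g == phi x :|: phi y).
Proof.
move=> xa ya ga.
have ubE h : (h <= a)%O -> upper_bound x y h = (phi x :|: phi y \subset phi h).
  by move=> ha; rewrite subUset !coord_sub.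
apply/andP/eqP => [[ubg /forallP ming]|e].
  have [z za zE] := co.2 (phi x :|: phi y).
  rewrite -zE; congr phi; apply/eqP; apply: contraT => gz.
  have /implyP := ming z; rewrite ubE // zE subxx => /(_ isT).
  by rewrite lt_neqAle eq_sym gz -(coord_sub za ga) zE -ubE // ubg.
split; first by rewrite ubE // e.
apply/forallP=> h; apply/implyP=> ubh; apply/negP=> hg.
have ha : (h <= a)%O by apply: le_trans (ltW hg) ga.
by move: ubh; rewrite ubE // -e coord_sub // lt_geF.
Qed.

Lemma coord_meet x y z : (x <= a)%O -> (y <= a)%O -> (z <= a)%O ->
  is_meet x y z = (phi z == phi x :&: phi y).
Proof.
move=> xa ya za; apply/forallP/eqP => [meetz|e w]; last first.
  have [wz|] := boolP (w <= z)%O.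
    have wa := le_trans wz za.
    by rewrite -(coord_sub wa xa) -(coord_sub wa ya) -subsetI -e coord_sub // wz.
  move=> wz; apply/eqP/esym/negbTE; apply: contraNN wz => /andP[wx wy].
  have wa := le_trans wx xa.
  by rewrite -(coord_sub wa za) e subsetI !coord_sub // wx.
have [w wa wE] := co.2 (phi x :&: phi y).
apply/eqP; rewrite eqEsubset -{2}wE subsetI !coord_sub //.
have := meetz z; rewrite lexx => /eqP/esym -> /=.
rewrite (eqP (meetz w)) -(coord_sub wa xa) -(coord_sub wa ya) wE.
by rewrite subsetIl subsetIr.
Qed.

(** Comparability read off from cardinals: summed over all pairs of faces of a
monomial, this becomes the criterion for standardness in [leqif_weight]. *)
Lemma leqif_coord x y : (x <= a)%O -> (y <= a)%O ->
  #|phi x :&: phi y| <= minn #|phi x| #|phi y| ?= iff (x >=< y)%O.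
Proof.
move=> xa ya; rewrite /Order.comparable -(coord_sub xa ya) -(coord_sub ya xa); split.
  by rewrite leq_min !(subset_leq_card, subsetIl, subsetIr).
apply/eqP/orP => [|[] sub]; last 2 first.
- by rewrite (setIidPl sub); apply/esym/minn_idPl/subset_leq_card.
- by rewrite (setIidPr sub); apply/esym/minn_idPr/subset_leq_card.
case: (leqP #|phi x| #|phi y|) => _ e; [left|right].
  by apply/setIidPl/eqP; rewrite eqEcard subsetIl e leqnn.
by apply/setIidPr/eqP; rewrite eqEcard subsetIr e leqnn.
Qed.

End Coordinates.

(** * Shape and energy of monomials *)

Section Sums.

(** This writes a squared norm as a quadratic form in the exponents.  It is used
with two Gram matrices: min(rk u, rk v) for the shape and the cardinal of the
common vertices of u and v for the image in a simplex. *)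
Lemma sum_mul_sum (I J : finType) (a : J -> I -> nat) (e f : J -> nat) :
  \sum_i (\sum_u a u i * e u) * (\sum_v a v i * f v) =
  \sum_u \sum_v e u * f v * \sum_i a u i * a v i.
Proof.
under eq_bigr => i _ do rewrite big_distrlr /=.
rewrite exchange_big; apply: eq_bigr => u _.
rewrite exchange_big; apply: eq_bigr => v _.
by rewrite big_distrr; apply: eq_bigr => i _; rewrite mulnACA mulnC.
Qed.

Lemma sum_staircase n p q : p <= n -> q <= n ->
  \sum_(i < n) (i < p) * (i < q) = minn p q.
Proof.
move=> pn qn; transitivity (\sum_(i < n | i < minn p q) 1).
  rewrite [RHS]big_mkcond; apply: eq_bigr => i _.
  by rewrite leq_min; do 2 case: (_ < _).
have le : minn p q <= n by rewrite geq_min pn.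
by rewrite -(big_ord_widen n (fun=> 1) le) sum1_card card_ord.
Qed.

Lemma sum_indicators N (A B : {set 'I_N}) :
  \sum_(i < N) (i \in A) * (i \in B) = #|A :&: B|.
Proof.
rewrite -sum1_card [RHS]big_mkcond; apply: eq_bigr => i _.
by rewrite inE; do 2 case: (_ \in _).
Qed.

End Sums.

Section Energy.
Variables (d : Order.disp_t) (P : finBPOrderType d).
Hypothesis hP : boolean_complex P.
Implicit Types (m : monom P) (u v : face P) (a : P).
Local Notation n := (rank_complex P).

Lemma rk_lt (x y : P) : (x < y)%O -> rk x < rk y.
Proof.
move=> xy; have [N [phi co]] := hP y.
have xy' := ltW xy; rewrite (rk_coord co xy') (rk_coord co (lexx y)).
apply: proper_card.
by rewrite properE (coord_sub co xy') // (coord_sub co) // xy' lt_geF.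
Qed.

Lemma rk_bot : rk (\bot%O : P) = 0.
Proof.
have [N [phi co]] := hP \bot%O.
by rewrite (rk_coord co) // (coord_bot co) cards0.
Qed.

Lemma rk_face_gt0 u : 0 < rk (val u).
Proof. by rewrite -rk_bot; apply: rk_lt; rewrite lt0x (valP u). Qed.

Lemma rk_le (x : P) : rk x <= n.
Proof. exact: (@leq_bigmax _ (@rk d P)). Qed.

Lemma comparable_rk_eq (x y : P) : (x >=< y)%O -> rk x = rk y -> x = y.
Proof. by case: comparableP => // /rk_lt + _ e; rewrite e ltnn. Qed.

Lemma expoD m m' u : expo (m + m')%MM u = expo m u + expo m' u.
Proof. exact: mnmDE. Qed.

Lemma expoU v u : expo U_(enum_rank v)%MM u = (v == u).
Proof. by rewrite /expo mnm1E (inj_eq enum_rank_inj). Qed.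

Lemma expo_inj m m' : expo m =1 expo m' -> m = m'.
Proof.
move=> e; apply/mnmP => i; have := e (enum_val i).
by rewrite /expo enum_valK.
Qed.

Lemma standardP m :
  reflect (forall u v, expo m u != 0 -> expo m v != 0 -> (val u >=< val v)%O)
          (standard m).
Proof.
rewrite /standard /chain; set C := [set _ | _ in _].
have Cval u : expo m u != 0 -> val u \in C.
  by move=> mu; apply: imset_f; rewrite inE.
apply: (iffP forall_inP) => [st u v /Cval mu /Cval mv|st _ /imsetP[u mu ->]].
  by have /forall_inP := st _ mu; apply.
apply/forall_inP => _ /imsetP[v mv ->].
by move: mu mv; rewrite !inE; apply: st.
Qed.

Lemma nonstandard_split m : ~~ standard m -> exists u v m0,
  ~~ (val u >=< val v)%O /\ m = (m0 + (U_(enum_rank u) + U_(enum_rank v)))%MM.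
Proof.
move=> nst.
have : ~ (forall u v, expo m u != 0 -> expo m v != 0 -> (val u >=< val v)%O).
  by move=> st; case/negP: nst; apply/standardP.
move=> /existsNP[u /existsNP[v /not_implyP[mu /not_implyP[mv /negP uv]]]].
exists u, v, (m - (U_(enum_rank u) + U_(enum_rank v)))%MM; split=> //.
have neq : enum_rank u != enum_rank v.
  by apply: contraNN uv => /eqP/enum_rank_inj ->; apply: comparablexx.
rewrite submK //; apply/mnm_lepP => i; rewrite mnmDE !mnm1E.
have [eu|_] := eqVneq (enum_rank u) i; have [ev|_] := eqVneq (enum_rank v) i.
- by rewrite eu ev eqxx in neq.
- by rewrite -eu lt0n.
- by rewrite -ev lt0n.
- by [].
Qed.

Lemma mulrn_nat (x y : nat) : (x *+ y)%R = x * y.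
Proof. by elim: y => [|y IH]; rewrite ?mulr0n ?muln0 // mulrS IH mulnS. Qed.

Lemma shapeE m i : shape m i = \sum_u (i < rk (val u)) * expo m u.
Proof.
rewrite /shape sum_ffunE; apply: eq_bigr => u _.
by rewrite ffunMnE ffunE mulrn_nat.
Qed.

Lemma shapeD m m' : shape (m + m')%MM = (shape m + shape m')%R.
Proof.
by rewrite -big_split; apply: eq_bigr => u _; rewrite expoD mulrnDr.
Qed.

Lemma shape0 : shape (0%MM : monom P) = 0%R.
Proof. by rewrite /shape big1 // => u _; rewrite /expo mnm0E mulr0n. Qed.

Lemma shapeU u : shape U_(enum_rank u)%MM = ones n (rk (val u)).
Proof.
rewrite /shape (bigD1 u) //= big1 ?expoU ?eqxx ?addr0 // => v vu.
by rewrite expoU eq_sym (negbTE vu) mulr0n.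
Qed.

Definition dot (l l' : {ffun 'I_n -> nat}) : nat := \sum_i l i * l' i.

Definition sqnorm l := dot l l.

(** Straightening lowers the shape in the dominance order.  The squared norm is
strictly monotone for that order on partitions of a given integer, and natural
numbers are easier to induct on. *)
Definition energy m := sqnorm (shape m).

Lemma dotC l l' : dot l l' = dot l' l.
Proof. by apply: eq_bigr => i _; rewrite mulnC. Qed.

Lemma dotDr l l1 l2 : dot l (l1 + l2)%R = dot l l1 + dot l l2.
Proof.
by rewrite /dot -big_split; apply: eq_bigr => i _; rewrite ffunE mulnDr.
Qed.

Lemma sqnormD l l' : sqnorm (l + l')%R = sqnorm l + 2 * dot l l' + sqnorm l'.
Proof. by rewrite /sqnorm !(dotDr, dotC (l + l')%R) (dotC l' l); lia. Qed.

Lemma dot_ones p q : p <= n -> q <= n -> dot (ones n p) (ones n q) = minn p q.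
Proof.
move=> pn qn; rewrite -(sum_staircase pn qn).
by apply: eq_bigr => i _; rewrite !ffunE.
Qed.

Lemma dot_shape_ones m p : p <= n ->
  dot (shape m) (ones n p) = \sum_u expo m u * minn (rk (val u)) p.
Proof.
move=> pn; rewrite /dot; under eq_bigr => i _ do rewrite shapeE big_distrl.
rewrite exchange_big; apply: eq_bigr => u _.
rewrite -(sum_staircase (rk_le _) pn) big_distrr; apply: eq_bigr => i _.
by rewrite ffunE /= mulnAC mulnC.
Qed.

Lemma energyE m :
  energy m = \sum_u \sum_v expo m u * expo m v * minn (rk (val u)) (rk (val v)).
Proof.
rewrite /energy /sqnorm /dot; under eq_bigr => i _ do rewrite !shapeE.
rewrite (sum_mul_sum (fun u (i : 'I_n) => nat_of_bool (i < rk (val u)))).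
apply: eq_bigr => u _; apply: eq_bigr => v _.
by rewrite sum_staircase ?rk_le.
Qed.

Lemma leqif_dot l l' : 2 * dot l l' <= sqnorm l + sqnorm l' ?= iff (l == l').
Proof.
have -> : (l == l') = [forall i, l i == l' i].
  by apply/eqP/eqfunP => [-> //|e]; apply/ffunP.
rewrite /sqnorm /dot big_distrr -big_split /=.
by apply: leqif_sum => i _; rewrite !mulnn; apply: nat_Cauchy.
Qed.

Definition below a m : bool := [forall u, (expo m u != 0) ==> (val u <= a)%O].

Lemma belowP a m :
  reflect (forall u, expo m u != 0 -> (val u <= a)%O) (below a m).
Proof. exact: 'forall_implyP. Qed.

(** The faces of a standard monomial form a chain, so the one of largest rank
contains the others. *)
Lemma standard_below m : standard m -> exists a, below a m.
Proof.
move=> /standardP st.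
have [u0 u0P|none] := pickP (fun u => expo m u != 0); last first.
  by exists \bot%O; apply/belowP => u; rewrite none.
case: (@arg_maxnP _ u0 (fun u => expo m u != 0) (fun u => rk (val u)) u0P).
move=> u mu umax.
exists (val u); apply/belowP => v mv.
have := st _ _ mv mu; have /= := umax v mv.
by case: comparableP => // /rk_lt; rewrite ltnNge => /negbTE ->.
Qed.

(** On a chain the rank determines the face, so the shape gives the exponents
back, from the largest rank downwards: if u has the largest rank among the faces
where m and m' differ, then in the part of index [rk u - 1] of both shapes all
terms but that of u agree. *)
Lemma standard_shape_inj m m' :
  standard (m + m')%MM -> shape m = shape m' -> m = m'.
Proof.
move=> /standardP st e; apply: expo_inj => u; apply/eqP; apply: contraT => neq.
case: (@arg_maxnP _ u (fun u => expo m u != expo m' u) (fun u => rk (val u)) neq).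
move=> {neq} {}u neq umax.
have supp v : expo m v != expo m' v -> expo (m + m')%MM v != 0.
  by apply: contraNN; rewrite expoD addn_eq0 => /andP[/eqP-> /eqP->].
have su := supp u neq.
(* Parts are indexed from 0: the part of index rk u - 1 counts the faces of
   rank at least rk u. *)
have ru : (rk (val u)).-1 < n by rewrite prednK ?rk_face_gt0 ?rk_le.
have := congr1 (fun l => (fun_of_fin l) (Ordinal ru)) e.
rewrite /= !shapeE !(bigD1 u (P := predT)) //= prednK ?rk_face_gt0 // leqnn !mul1n.
rewrite [X in _ + X = _ -> _]
  (eq_bigr (fun v => (rk (val u) <= rk (val v)) * expo m' v)).
  by move=> /addIn eu; rewrite eu eqxx in neq.
move=> v vu; have [uv|//] := leqP; rewrite !mul1n.
apply/eqP; apply: contraT => neqv.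
have sv := supp v neqv.
have ruv : rk (val v) = rk (val u).
  by apply/eqP; rewrite eqn_leq uv andbT; apply: umax.
by rewrite (val_inj (comparable_rk_eq (st _ _ sv su) ruv)) eqxx in vu.
Qed.

Section Weight.
Variables (a : P) (N : nat) (phi : P -> {set 'I_N}).
Hypothesis co : coordinates a phi.

(** The exponents, in the vertices of a, of the image of x^m under restriction
to a. *)
Definition weight m : 'X_{1..N} :=
  [multinom \sum_u (i \in phi (val u)) * expo m u | i < N].

(** Both sides are quadratic forms in the exponents, and [leqif_coord] compares
their coefficients one pair of faces at a time. *)
Lemma leqif_weight m : below a m ->
  \sum_i weight m i * weight m i <= energy m ?= iff standard m.
Proof.
move=> /belowP mb.
under eq_bigr => i _ do rewrite mnmE.
rewrite (sum_mul_sum (fun u (i : 'I_N) => nat_of_bool (i \in phi (val u)))).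
rewrite energyE.
have -> : standard m = [forall u, [forall v,
    (expo m u * expo m v == 0) || (val u >=< val v)%O]].
  apply/standardP/forallP => [st u|st u v mu mv].
    apply/forallP => v; rewrite muln_eq0; apply/orP.
    by have [|mu] := eqVneq; [left|have [|mv] := eqVneq; [left|right; apply: st]].
  by have /forallP/(_ v) := st u; rewrite muln_eq0 (negbTE mu) (negbTE mv).
apply: leqif_sum => u _; apply: leqif_sum => v _.
rewrite sum_indicators.
have [->|nz] := eqVneq (expo m u * expo m v) 0; first by rewrite !mul0n; split.
move: (nz); rewrite muln_eq0 negb_or => /andP[/mb ua /mb va].
rewrite (rk_coord co ua) (rk_coord co va) /=.
have mono : {mono muln (expo m u * expo m v) : x y / x <= y}.
  by move=> x y; rewrite leq_pmul2l ?lt0n.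
by rewrite (mono_leqif mono); apply: (leqif_coord co ua va).
Qed.

(** The Cauchy-Schwarz inequality replaces a combinatorial reconstruction of the
chain.  Let w be the common weight, and l, l' the shapes.  Both shapes have
squared norm |w|^2, so l + l' has squared norm at most 4 |w|^2.  But
[m + m'] has weight 2 w, so its energy is at least 4 |w|^2.  Equality holds
throughout: l = l', and [m + m'] is standard, so that
[standard_shape_inj] applies. *)
Lemma weight_inj m m' : below a m -> below a m' -> standard m -> standard m' ->
  weight m = weight m' -> m = m'.
Proof.
move=> mb mb' st st' e.
have mmb : below a (m + m')%MM.
  apply/belowP=> u; rewrite expoD addn_eq0 negb_and => /orP[].
    exact: (belowP _ _ mb).
  exact: (belowP _ _ mb').
have [_] := leqif_weight mb; rewrite st => /eqP e1.
have [_] := leqif_weight mb'; rewrite st' -e => /eqP e2.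
have := leqif_weight mmb.
have -> : \sum_i weight (m + m')%MM i * weight (m + m')%MM i =
    4 * \sum_i weight m i * weight m i.
  have wD : weight (m + m')%MM = (weight m + weight m)%MM.
    rewrite {2}e; apply/mnmP => i; rewrite mnmDE !mnmE -big_split.
    by apply: eq_bigr => u _; rewrite expoD mulnDr.
  rewrite wD big_distrr; apply: eq_bigr => i _.
  by rewrite /= mnmDE mulnDl mulnDr; lia.
rewrite {1}/energy shapeD sqnormD -/(energy m) -/(energy m').
have := leqif_dot (shape m) (shape m'); rewrite -/(energy m) -/(energy m').
move=> [le1 eq1] [le2 eq2].
apply: standard_shape_inj; first by rewrite -eq2; apply/eqP; lia.
by apply/eqP; rewrite -eq1; apply/eqP; lia.
Qed.

End Weight.

End Energy.

(** * Both rings as quotients of one polynomial ring *)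

Local Open Scope ring_scope.

Section QuotientMap.
Variables (k : comNzRingType) (A : comAlgType k) (I : idealr A).

HB.instance Definition _ := GRing.isScalable.Build k A {ideal_quot I} *:%R
  (\pi_{ideal_quot I}) (@pi_quot_scalable k A I).

Lemma pi_eq0 x : (\pi_{ideal_quot I} x == 0) = (x \in I).
Proof.
by rewrite -(rmorph0 (\pi_{ideal_quot I})) -Quotient.idealrBE subr0.
Qed.

End QuotientMap.

Section Evaluation.
Variables (k : fieldType) (n : nat).
Implicit Types (p q : {mpoly k[n]}) (m : 'X_{1..n}).

Lemma mpoly_linear_ext (V : lmodType k) (g h : {linear {mpoly k[n]} -> V}) :
  (forall m, g 'X_[m] = h 'X_[m]) -> g =1 h.
Proof.
move=> gh p; rewrite [p]mpolyE (linear_sum g) (linear_sum h).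
by apply: eq_bigr => m _; rewrite (linearZ_LR g) (linearZ_LR h) gh.
Qed.

Section Def.
Variable B : comAlgType k.

Definition aeval (z : 'I_n -> B) : {mpoly k[n]} -> B := mmap (in_alg B) z.

HB.instance Definition _ z := GRing.RMorphism.copy (aeval z) (mmap (in_alg B) z).

Lemma aeval_scalable z : scalable (aeval z).
Proof. by move=> c p; rewrite /aeval mmapZ mulr_algl. Qed.

HB.instance Definition _ z :=
  GRing.isScalable.Build k {mpoly k[n]} B *:%R (aeval z) (@aeval_scalable z).

Lemma aevalX z m : aeval z 'X_[m] = \prod_i z i ^+ m i.
Proof. exact: mmapX. Qed.

Lemma aevalXU z i : aeval z 'X_i = z i.
Proof. by rewrite /aeval mmapX mmap1U. Qed.

Lemma aevalE z p : aeval z p = \sum_(m <- msupp p) p@_m *: aeval z 'X_[m].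
Proof.
rewrite {1}[p]mpolyE (linear_sum (aeval z)).
by apply: eq_bigr => m _; rewrite (linearZ_LR (aeval z)).
Qed.

Lemma eq_aeval z z' : z =1 z' -> aeval z =1 aeval z'.
Proof.
move=> zz' p; rewrite /aeval /mmap; apply: eq_bigr => m _.
by congr (_ * _); apply: mmap1_eq.
Qed.

End Def.

Lemma aeval_comp (B C : comAlgType k) (g : {lrmorphism B -> C}) z p :
  g (aeval z p) = aeval (g \o z) p.
Proof.
apply: (mpoly_linear_ext (g := g \o aeval z)) p => m /=.
by rewrite !aevalX rmorph_prod; apply: eq_bigr => i _; rewrite rmorphXn.
Qed.

Lemma aeval_id p : aeval (fun i => 'X_i) p = p.
Proof.
apply: (mpoly_linear_ext (h := idfun)) p => m /=.
by rewrite aevalX -mpolyXE_id.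
Qed.

(** Used to extract the standard part and the layers of given energy. *)
Definition keep (T : pred 'X_{1..n}) p : {mpoly k[n]} :=
  \sum_(m <- msupp p | T m) p@_m *: 'X_[m].

Lemma mcoeff_keep T p m : (keep T p)@_m = if T m then p@_m else 0.
Proof.
rewrite raddf_sum /=; under eq_bigr do rewrite mcoeffZ mcoeffX.
have [mp|mp] := boolP (m \in msupp p); last first.
  rewrite (memN_msupp_eq0 mp) if_same big_seq_cond big1 // => m' /andP[mp' _].
  by case: eqP mp' => [->|]; [rewrite (negbTE mp)|rewrite mulr0].
rewrite big_mkcond (bigD1_seq m) ?msupp_uniq //= eqxx mulr1 big1 ?addr0 // => m'.
by move=> /negbTE ->; rewrite mulr0 if_same.
Qed.

Lemma keep_is_linear T : linear (keep T).
Proof.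
move=> c p q; apply/mpolyP => m; rewrite !(mcoeffD, mcoeffZ, mcoeff_keep).
by case: (T m); rewrite // mulr0 addr0.
Qed.

HB.instance Definition _ T :=
  GRing.isLinear.Build k {mpoly k[n]} {mpoly k[n]} _ (keep T) (keep_is_linear T).

Lemma msupp_keep T p m : (m \in msupp (keep T p)) = T m && (m \in msupp p).
Proof. by rewrite !mcoeff_msupp mcoeff_keep; case: (T m); rewrite ?eqxx. Qed.

Lemma keep_all (T : pred 'X_{1..n}) p :
  {in msupp p, forall m, T m} -> keep T p = p.
Proof.
move=> Tp; apply/mpolyP => m; rewrite mcoeff_keep; case: ifP => // nT.
have [/Tp|/memN_msupp_eq0 //] := boolP (m \in msupp p).
by rewrite nT.
Qed.

Lemma keep_none (T : pred 'X_{1..n}) p :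
  {in msupp p, forall m, ~~ T m} -> keep T p = 0.
Proof.
move=> Tp; apply/mpolyP => m; rewrite mcoeff_keep mcoeff0; case: ifP => // mT.
have [/Tp|/memN_msupp_eq0 //] := boolP (m \in msupp p).
by rewrite mT.
Qed.

End Evaluation.

Section Quotients.
Variables (d : Order.disp_t) (P : finBPOrderType d) (k : fieldType).
Local Notation A := (polySd P k).
Implicit Types (p : A) (m : monom P).

(** The nonempty faces suffice because the generator of the empty face is 1. *)
Definition toD : A -> kD P k := aeval (fun i => xgen k (val (enum_val i))).
Definition toSd : A -> kSd P k := aeval (fun i => ygen k (enum_val i)).

HB.instance Definition _ := GRing.LRMorphism.copy toD
  (aeval (fun i => xgen k (val (enum_val i)))).
HB.instance Definition _ := GRing.LRMorphism.copy toSd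
  (aeval (fun i => ygen k (enum_val i))).

Lemma toD_X m : toD 'X_[m] = xmon k m.
Proof.
rewrite /toD aevalX (reindex enum_rank) /=; last first.
  exact: (onW_bij _ (@enum_rank_bij _)).
by apply: eq_bigr => u _; rewrite enum_rankK.
Qed.

Lemma toSdE p : toSd p = \pi_{ideal_quot (idealSd P k)} p.
Proof.
rewrite -[in RHS](aeval_id p) (aeval_comp (\pi_{ideal_quot (idealSd P k)})).
by apply: eq_aeval => i; rewrite /ygen /varSd /= enum_valK.
Qed.

Lemma garsia_toSd p : garsia (toSd p) = toD (keep (@standard d P) p).
Proof.
rewrite toSdE garsia_pi linear_sum; apply: eq_bigr => m _.
by rewrite linearZ /= toD_X.
Qed.

Lemma toSd_nonstandard m : ~~ standard m -> toSd 'X_[m] = 0.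
Proof.
case/nonstandard_split=> u [v [m0 [uv ->]]].
rewrite toSdE !mpolyXD rmorphM /=.
have -> : \pi_{ideal_quot (idealSd P k)} ('X_(enum_rank u) * 'X_(enum_rank v)) = 0.
  apply/eqP; rewrite pi_eq0; apply/asboolP.
  by apply: gen_ideal_gen; apply: RelSd.
by rewrite mulr0.
Qed.

(** The ideal of k[Sd Delta] is spanned by the nonstandard monomials. *)
Lemma toSd_keep p : toSd (keep (@standard d P) p) = toSd p.
Proof.
rewrite {2}[p]mpolyE (bigID (@standard d P)) /= linearD /=.
rewrite [X in _ + X]linear_sum [X in _ + X]big1 ?addr0 // => m nst.
by rewrite linearZ /= toSd_nonstandard ?scaler0.
Qed.

Lemma toSd_eq0 (B : comAlgType k) (z : face P -> B) p :
  (forall u v, ~~ (val u >=< val v)%O -> z u * z v = 0) ->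
  toSd p = 0 -> aeval (fun i => z (enum_val i)) p = 0.
Proof.
move=> zrel /eqP; rewrite toSdE pi_eq0 => /asboolP[N [c [s [rs ->]]]].
rewrite rmorph_sum big1 // => i _; rewrite rmorphM; case: (rs i) => u v uv.
by rewrite rmorphM /= !aevalXU !enum_rankK zrel ?mulr0.
Qed.

(** The universal property of k[Delta]: values for the generators that satisfy
the relations define a morphism, which therefore kills the kernel of [toD]. *)
Lemma toD_eq0 (B : comAlgType k) (z : P -> B) p :
  (forall q, relD q -> aeval (fun i => z (enum_val i)) q = 0) ->
  toD p = 0 -> aeval (fun i => z (val (enum_val i))) p = 0.
Proof.
move=> zrel.
pose lift : A -> polyD P k := aeval (fun i => varD k (val (enum_val i))).
have -> : toD p = \pi_{ideal_quot (idealD P k)} (lift p).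
  rewrite /lift (aeval_comp (\pi_{ideal_quot (idealD P k)})).
  exact: eq_aeval.
move=> /eqP; rewrite pi_eq0 => /asboolP[N [c [s [rs e]]]].
have -> : aeval (fun i => z (val (enum_val i))) p =
    aeval (fun i => z (enum_val i)) (lift p).
  rewrite /lift aeval_comp; apply: eq_aeval => i /=.
  by rewrite /varD aevalXU enum_rankK.
rewrite e rmorph_sum big1 // => i _.
by rewrite rmorphM [X in _ * X](zrel _ (rs i)) mulr0.
Qed.

(** A lift of x is obtained from a representative by setting the variable of the
empty face to 1. *)
Lemma toD_surj (x : kD P k) : exists p, toD p = x.
Proof.
pose low a : A := if insub a is Some u then 'X_(enum_rank (u : face P)) else 1.
exists (aeval (fun i => low (enum_val i)) (repr x)).
rewrite aeval_comp -[RHS]reprK -[in RHS](aeval_id (repr x)).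
rewrite (aeval_comp (\pi_{ideal_quot (idealD P k)})); apply: eq_aeval => i /=.
have -> : 'X_i = varD k (enum_val i) by rewrite /varD enum_valK.
rewrite /= /low; case: insubP => [u _ <-|].
  by rewrite /toD aevalXU enum_rankK.
rewrite negbK => /eqP ->; rewrite rmorph1.
apply/esym/eqP; rewrite -(rmorph1 (\pi_{ideal_quot (idealD P k)})).
rewrite -Quotient.idealrBE; apply/asboolP.
by apply: gen_ideal_gen; apply: RelD_bot.
Qed.

End Quotients.

(** * Restriction to a simplex *)

Section Localization.
Variables (d : Order.disp_t) (P : finBPOrderType d) (k : fieldType).
Hypothesis hP : boolean_complex P.
Local Notation A := (polySd P k).
Implicit Types (p : A) (m : monom P).

Section Local.
Variables (a : P) (N : nat) (phi : P -> {set 'I_N}).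
Hypothesis co : coordinates a phi.

Definition vertices (b : P) : 'X_{1..N} := [multinom (i \in phi b : nat) | i < N].

Definition local_var (b : P) : {mpoly k[N]} :=
  if (b <= a)%O then 'X_[vertices b] else 0.

(** The product of the vertices of b and of those of c is that of their common
vertices and of all their vertices; the latter form the only minimal upper bound
of b and c in a, and the other minimal upper bounds are sent to 0. *)
Lemma local_var_rel q : relD q -> aeval (fun i => local_var (enum_val i)) q = 0.
Proof.
have evX b : aeval (fun i => local_var (enum_val i)) (varD k b) = local_var b.
  by rewrite /varD aevalXU enum_rankK.
case=> [|b c nub|b c m ub meetm].
- rewrite rmorphB rmorph1 /= evX /local_var le0x.
  have -> : vertices \bot%O = 0%MM.
    by apply/mnmP => i; rewrite mnmE mnm0E (coord_bot co) inE.
  by rewrite mpolyX0 subrr.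
- rewrite rmorphM /= !evX /local_var.
  case: ifP => ba; last by rewrite mul0r.
  case: ifP => ca; last by rewrite mulr0.
  by case/negP: nub; apply/existsP; exists a; rewrite /upper_bound ba ca.
rewrite rmorphB !rmorphM rmorph_sum /= !evX.
under eq_bigr do rewrite evX.
have mb : (m <= b)%O /\ (m <= c)%O.
  by apply/andP; rewrite -(eqP (forallP meetm m)) lexx.
have [/andP[ba ca]|nbc] := boolP ((b <= a)%O && (c <= a)%O); last first.
  rewrite [X in X - _](_ : _ = 0); last first.
    move: nbc; rewrite /local_var negb_and; case: ifP => _ /= nca.
      by rewrite (negbTE nca) mulr0.
    by rewrite mul0r.
  rewrite big1 ?mulr0 ?subrr // => g /andP[/andP[bg cg] _].
  rewrite /local_var; case: ifP => // ga.
  by move: nbc; rewrite (le_trans bg ga) (le_trans cg ga).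
have ma : (m <= a)%O := le_trans mb.1 ba.
have [j ja jE] := co.2 (phi b :|: phi c).
rewrite (bigD1 j) /=; last by rewrite (coord_min_upper_bound co) ?jE.
rewrite big1 ?addr0 => [|g /andP[ming gj]]; last first.
  rewrite /local_var; case: ifP => // ga; case/negP: gj; apply/eqP.
  apply: (coord_inj co) => //; rewrite jE; apply/eqP.
  by rewrite -(coord_min_upper_bound co).
rewrite /local_var ba ca ma ja -!mpolyXD; apply/eqP; rewrite subr_eq0; apply/eqP.
congr ('X_[_]); apply/mnmP => i; rewrite !mnmDE !mnmE.
move: meetm; rewrite (coord_meet co) // => /eqP ->; rewrite jE !inE.
by case: (i \in phi b); case: (i \in phi c).
Qed.

Lemma local_monomial m :
  aeval (fun i => local_var (val (enum_val i))) 'X_[m] =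
    if below a m then 'X_[weight phi m] else 0.
Proof.
rewrite aevalX (reindex enum_rank) /=; last first.
  exact: (onW_bij _ (@enum_rank_bij _)).
under eq_bigr => u _ do rewrite enum_rankK -/(expo m u).
case: ifPn => [/belowP mb|/forallPn[u]]; last first.
  rewrite negb_imply => /andP[mu ua]; rewrite (bigD1 u) //= /local_var.
  by rewrite (negbTE ua) expr0n (negbTE mu) mul0r.
transitivity (\prod_(u : face P) 'X_[vertices (val u)] ^+ expo m u : {mpoly k[N]}).
  apply: eq_bigr => u _; rewrite /local_var.
  have [->|mu] := eqVneq (expo m u) 0%N; first by rewrite !expr0.
  by rewrite (mb u mu).
rewrite mprodXnE; congr ('X_[_]); apply/mnmP => i.
rewrite mnm_sumE mnmE; apply: eq_bigr => u _.
by rewrite mulmnE mnmE.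
Qed.

End Local.

(** Compare in p the coefficients of the monomials whose image in a simplex
containing m is that of m.  Their energy is at least the squared norm of the
weight of m, which is q since m is standard, and at most q by assumption.  Hence
they are standard too, and [weight_inj] leaves only m. *)
Lemma leading_standard_eq0 p q : toD p = 0 ->
  {in msupp p, forall m, (energy m <= q)%N} ->
  forall m, standard m -> energy m = q -> p@_m = 0.
Proof.
move=> p0 pq m stm mq.
have [a ma] := standard_below hP stm.
have [N [phi co]] := hP a.
have := toD_eq0 (local_var_rel co) p0.
move=> /(congr1 (mcoeff (weight phi m))); rewrite mcoeff0 => <-.
rewrite aevalE raddf_sum /=.
have term m' : m' \in msupp p ->
    (p@_m' *: aeval (fun i => local_var a phi (val (enum_val i))) 'X_[m'])@_(weight phi m)
    = p@_m' * (m' == m)%:R.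
  move=> m'p; rewrite mcoeffZ local_monomial; congr (_ * _).
  have [->|ne] := eqVneq m' m; first by rewrite ma mcoeffX eqxx.
  case: ifP => m'a; last by rewrite mcoeff0.
  rewrite mcoeffX; case: eqP => // e; case/eqP: ne.
  apply: (weight_inj hP co m'a ma) => //.
  have [le eq] := leqif_weight co m'a.
  have [_] := leqif_weight co ma; rewrite stm -e => /eqP e2.
  by rewrite -eq eqn_leq le /= e2 mq; apply: pq.
rewrite big_seq (eq_bigr _ term) -big_seq.
have [mp|mp] := boolP (m \in msupp p); last first.
  rewrite (memN_msupp_eq0 mp) big_seq big1 // => m' m'p.
  by case: eqP m'p => [->|]; [rewrite (negbTE mp)|rewrite mulr0].
rewrite (bigD1_seq m) ?msupp_uniq //= eqxx mulr1 big1 ?addr0 // => m'.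
by move=> /negbTE ->; rewrite mulr0.
Qed.

(** The standard monomials are linearly independent in k[Delta]: peel off the
layers from the top. *)
Lemma standard_indep p :
  {in msupp p, forall m, standard m} -> toD p = 0 -> p = 0.
Proof.
move=> pst p0.
have main q : {in msupp p, forall m, (energy m <= q)%N} -> p = 0.
  elim: q => [|q IH] pq.
    apply/mpolyP => m; rewrite mcoeff0.
    have [mp|/memN_msupp_eq0 //] := boolP (m \in msupp p).
    apply: (leading_standard_eq0 p0 pq); first exact: pst.
    by apply/eqP; rewrite -leqn0 pq.
  apply: IH => m mp; rewrite -ltnS ltn_neqAle pq // andbT.
  apply/eqP => e; move: (mp); rewrite mcoeff_msupp.
  by rewrite (leading_standard_eq0 p0 pq) ?eqxx // pst.
apply: (main (\max_(m <- msupp p) energy m)) => m mp.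
exact: leq_bigmax_seq.
Qed.

(** The Garsia transfer takes the problem to k[Delta], where [standard_indep] is
available. *)
Lemma toSd_eq0_standard p : toSd p = 0 -> keep (@standard d P) p = 0.
Proof.
move=> p0; apply: standard_indep; last by rewrite -garsia_toSd p0 linear0.
by move=> m; rewrite msupp_keep => /andP[].
Qed.

End Localization.

(** * Straightening *)

Section Straightening.
Variables (d : Order.disp_t) (P : finBPOrderType d) (k : fieldType).
Hypothesis hP : boolean_complex P.
Implicit Types (m : monom P) (b c g z : P).
Local Notation n := (rank_complex P).

(** The empty face gives the trivial monomial, because its generator is 1; so the
meet of two faces can be treated like any other face. *)
Definition face_mnm b : monom P :=
  if insub b is Some u then U_(enum_rank (u : face P))%MM else 0%MM.

Lemma xmonD m m' : xmon k (m + m')%MM = xmon k m * xmon k m'.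
Proof. by rewrite -!toD_X mpolyXD rmorphM. Qed.

Lemma pi_relD q : relD q -> \pi_{ideal_quot (idealD P k)} q = 0.
Proof. by move=> rq; apply/eqP; rewrite pi_eq0; apply/asboolP/gen_ideal_gen. Qed.

Lemma xgen_bot : xgen k (\bot%O : P) = 1.
Proof.
by apply/eqP; rewrite -subr_eq0 -(pi_relD (RelD_bot P k)) rmorphB rmorph1.
Qed.

Lemma xmon_face_mnm b : xmon k (face_mnm b) = xgen k b.
Proof.
rewrite -toD_X /face_mnm; case: insubP => [u _ <-|].
  by rewrite /toD aevalXU enum_rankK.
by rewrite negbK => /eqP ->; rewrite mpolyX0 rmorph1 xgen_bot.
Qed.

Lemma shape_face_mnm b : shape (face_mnm b) = ones n (rk b).
Proof.
rewrite /face_mnm; case: insubP => [u _ <-|]; first exact: shapeU.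
rewrite negbK => /eqP ->; rewrite shape0 (rk_bot hP).
by apply/ffunP => i; rewrite !ffunE.
Qed.

(** In the simplex g the meet and g are the intersection and the union of the
vertex sets of b and c. *)
Lemma min_upper_bound_rk b c z g : ~~ (b >=< c)%O -> is_meet b c z ->
  min_upper_bound b c g ->
  (rk z < minn (rk b) (rk c))%N /\ (rk z + rk g = rk b + rk c)%N.
Proof.
move=> bc meetz ming; have /andP[/andP[bg cg] _] := ming.
have zb : (z <= b)%O.
  by have := forallP meetz z; rewrite lexx => /eqP/esym/andP[].
have zg := le_trans zb bg.
have [N [phi co]] := hP g.
move: meetz ming; rewrite (coord_meet co bg cg zg) => /eqP zE.
rewrite (coord_min_upper_bound co bg cg (lexx g)) => /eqP gE.
rewrite !(rk_coord co) //; split; last by rewrite zE gE addnC cardsUI.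
by rewrite zE (ltn_leqif (leqif_coord co bg cg)).
Qed.

(** The shape changes from l + l_b + l_c to l + l_z + l_g, where l_x is the column
of height rk x.  The rank sum is the same and the ranks of z and g are further
apart, so the scalar product with l does not grow, min(rk, _) being concave, and
the squared norm of the other part drops because rk z < min(rk b, rk c). *)
Lemma energy_straighten m b c z g : ~~ (b >=< c)%O -> is_meet b c z ->
  min_upper_bound b c g ->
  (energy (m + (face_mnm z + face_mnm g))%MM <
     energy (m + (face_mnm b + face_mnm c))%MM)%N.
Proof.
move=> bc meetz /(min_upper_bound_rk bc meetz)[zlt zg].
rewrite /energy !shapeD !shape_face_mnm !sqnormD !dotDr /sqnorm.
rewrite !dot_ones ?rk_le // !dot_shape_ones ?rk_le // -!big_split /=.
have le : (\sum_(u : face P) (expo m u * minn (rk (val u)) (rk z) +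
                expo m u * minn (rk (val u)) (rk g)) <=
   \sum_(u : face P) (expo m u * minn (rk (val u)) (rk b) +
                expo m u * minn (rk (val u)) (rk c)))%N.
  apply: leq_sum => u _; rewrite -!mulnDr leq_mul2l; apply/orP; right; lia.
by move: le => /=; lia.
Qed.

Lemma meet_exists b c g : upper_bound b c g -> exists z, is_meet b c z.
Proof.
case/andP=> bg cg; have [N [phi co]] := hP g.
have [z zg zE] := co.2 (phi b :&: phi c).
by exists z; rewrite (coord_meet co) // zE.
Qed.

(** One use of the relation of two incomparable faces of m. *)
Lemma xmon_straighten m : ~~ standard m -> exists s : seq (monom P),
  {in s, forall m', (energy m' < energy m)%N} /\
  xmon k m = \sum_(m' <- s) xmon k m'.
Proof.
case/nonstandard_split => u [v [m0 [uv ->]]].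
have -> : (U_(enum_rank u) + U_(enum_rank v) =
           face_mnm (val u) + face_mnm (val v))%MM.
  by rewrite /face_mnm !valK.
rewrite xmonD xmonD !xmon_face_mnm.
have [hub|nub] := boolP (has_upper_bound (val u) (val v)); last first.
  exists [::]; split=> //; rewrite big_nil.
  have := pi_relD (RelD_unbounded k nub); rewrite rmorphM => e.
  by rewrite [X in _ * X]e mulr0.
have [g ub] := existsP hub; have [z meetz] := meet_exists ub.
exists [seq (m0 + (face_mnm z + face_mnm g))%MM
       | g <- enum (min_upper_bound (val u) (val v))]; split.
  by move=> _ /mapP[h + ->]; rewrite mem_enum; apply: energy_straighten.
have /eqP := pi_relD (RelD_bounded k hub meetz).
rewrite rmorphB !rmorphM rmorph_sum subr_eq0 => /eqP e.
rewrite [X in _ * X = _]e big_map big_enum mulrA mulr_sumr; apply: eq_bigr => h _.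
by rewrite !xmonD !xmon_face_mnm mulrA.
Qed.

End Straightening.

(** * The rank parameters *)

Section RankSums.
Variables (d : Order.disp_t) (P : finBPOrderType d) (k : fieldType).
Hypothesis hP : boolean_complex P.
Local Notation A := (polySd P k).
Local Notation n := (rank_complex P).
Implicit Types (p : {mpoly k[n]}) (e : 'X_{1..n}) (F : A).

Definition rank_sum (j : nat) : A :=
  \sum_(u : face P | rk (val u) == j) 'X_(enum_rank u).

(** The common lift of the elements of k[Theta] and k[Gamma]. *)
Definition in_rank_sums : {mpoly k[n]} -> A :=
  aeval (fun i : 'I_n => rank_sum i.+1).

HB.instance Definition _ := GRing.LRMorphism.copy in_rank_sums
  (aeval (fun i : 'I_n => rank_sum i.+1)).

Lemma toD_rank_sums p :
  toD (in_rank_sums p) = aeval (fun i : 'I_n => theta P k i.+1) p.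
Proof.
rewrite /in_rank_sums (aeval_comp (@toD d P k)); apply: eq_aeval => i /=.
rewrite /rank_sum linear_sum; apply: eq_bigr => u _.
by rewrite /= /toD aevalXU enum_rankK.
Qed.

Lemma toSd_rank_sums p :
  toSd (in_rank_sums p) = aeval (fun i : 'I_n => gamma P k i.+1) p.
Proof.
rewrite /in_rank_sums (aeval_comp (@toSd d P k)); apply: eq_aeval => i /=.
rewrite /rank_sum linear_sum; apply: eq_bigr => u _.
by rewrite /= /toSd aevalXU enum_rankK.
Qed.

(** A face of maximal rank n is a simplex with n vertices; take the faces spanned
by its first j vertices, j = 1, .., n. *)
Lemma full_flag : exists u : 'I_n -> face P,
  (forall j, rk (val (u j)) = j.+1) /\ forall i j, (val (u i) >=< val (u j))%O.
Proof.
have P0 : (0 < #|P|)%N by apply/card_gt0P; exists \bot%O.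
have [a na] := bigop.eq_bigmax (@rk d P) P0.
have [N [phi co]] := hP a.
have nN : N = n.
  by rewrite /rank_complex na (rk_coord co) // (coord_top co) cardsT card_ord.
subst N; have [pre preP] := coord_surj co.
pose S j := [set i : 'I_n | (i < j.+1)%N].
have rkS (j : 'I_n) : rk (pre (S j)) = j.+1.
  have [le _] := preP (S j); rewrite (rk_coord co le) (preP _).2.
  rewrite -sum1_card (eq_bigl (fun i : 'I_n => (i < j.+1)%N)) => [|i].
    by rewrite -(big_ord_widen n (fun=> 1%N) (ltn_ord j)) sum1_card card_ord.
  by rewrite inE.
have nbot (j : 'I_n) : pre (S j) != \bot%O.
  by apply/eqP => e; have := rkS j; rewrite e (rk_bot hP).
exists (fun j : 'I_n => Sub (pre (S j)) (nbot j) : face P).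
split=> [j|i j]; rewrite ?SubK //=.
have le (i' j' : 'I_n) : (i' <= j')%N -> (pre (S i') <= pre (S j'))%O.
  move=> ij; rewrite -(coord_sub co (preP _).1 (preP _).1) !(preP _).2.
  by apply/subsetP => l; rewrite !inE => /leq_trans; apply.
by rewrite /Order.comparable; case/orP: (leq_total i j) => /le -> //; rewrite orbT.
Qed.

(** Sending y_u to a variable of its own for u in a full flag, and to 0
otherwise, respects the relations and maps gamma_j to the j-th variable. *)
Lemma gamma_algebraically_independent p : toSd (in_rank_sums p) = 0 -> p = 0.
Proof.
have [u [rku comp]] := full_flag.
have uinj : injective u.
  by move=> i j e; apply/val_inj/succn_inj; rewrite -!rku e.
pose z (w : face P) : {mpoly k[n]} :=
  if [pick j | u j == w] is Some j then 'X_j else 0.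
have zrel w w' : ~~ (val w >=< val w')%O -> z w * z w' = 0.
  rewrite /z; case: pickP => [i /eqP <-|_]; last by rewrite mul0r.
  case: pickP => [j /eqP <-|_]; last by rewrite mulr0.
  by rewrite comp.
move=> /(toSd_eq0 zrel); rewrite /in_rank_sums (aeval_comp (aeval _)) /= => <-.
rewrite -{1}(aeval_id p); apply: eq_aeval => j /=.
rewrite /rank_sum linear_sum (bigD1 (u j)) /= ?rku //.
rewrite aevalXU enum_rankK {1}/z; case: pickP => [i /eqP/uinj ->|/(_ j)]; last first.
  by rewrite eqxx.
rewrite big1 ?addr0 // => w /andP[/eqP rw wj].
rewrite aevalXU enum_rankK /z; case: pickP => // l /eqP ulw.
by move: rw wj; rewrite -ulw rku => -[/val_inj ->]; rewrite eqxx.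
Qed.

Definition has_shape (lam : {ffun 'I_n -> nat}) F : Prop :=
  {in msupp F, forall m, shape m = lam}.

Lemma has_shapeX m : has_shape (shape m) ('X_[m] : A).
Proof. by move=> m'; rewrite msuppX inE => /eqP ->. Qed.

Lemma has_shape_sum I (r : seq I) (Q : pred I) (F : I -> A) lam :
  (forall i, Q i -> has_shape lam (F i)) ->
  has_shape lam (\sum_(i <- r | Q i) F i).
Proof.
move=> FP; apply: big_ind => // [m|F1 F2 h1 h2 m]; first by rewrite msupp0.
by move=> /msuppD_le; rewrite mem_cat => /orP[/h1|/h2].
Qed.

Lemma has_shapeZ (c : k) F lam : has_shape lam F -> has_shape lam (c *: F).
Proof. by move=> h m /msuppZ_le/h. Qed.

Lemma has_shapeM F1 F2 l1 l2 :
  has_shape l1 F1 -> has_shape l2 F2 -> has_shape (l1 + l2) (F1 * F2).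
Proof.
move=> h1 h2 m /msuppM_le/allpairsP[[m1 m2] /= [/h1 <- /h2 <- ->]].
exact: shapeD.
Qed.

(** The shape of the monomials in the lift of the product of the
gamma_(i+1)^(e i). *)
Definition exponent_shape e : {ffun 'I_n -> nat} :=
  \sum_(i < n) ones n i.+1 *+ e i.

Lemma in_rank_sumsX_shape e : has_shape (exponent_shape e) (in_rank_sums 'X_[e]).
Proof.
have shape_one : has_shape 0 1.
  by move=> m; rewrite msupp1 inE => /eqP ->; apply: shape0.
rewrite /in_rank_sums aevalX /exponent_shape.
apply: (big_ind2 (fun F l => has_shape l F)) => // [F l F' l'|i _].
  exact: has_shapeM.
elim: (e i) => [|c IH]; first by rewrite expr0 mulr0n.
rewrite exprS mulrS; apply: has_shapeM => //.
by apply: has_shape_sum => u /eqP <-; rewrite -shapeU; apply: has_shapeX.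
Qed.

Definition shifted_energy (lam : {ffun 'I_n -> nat}) e : nat :=
  sqnorm (exponent_shape e + lam).

(** The lift of a monomial in the parameters and F are both homogeneous with
respect to shape, hence so is their product: a layer keeps it whole or drops
it. *)
Lemma keep_energyM (T : pred nat) p F lam : has_shape lam F ->
  keep (fun m => T (energy m)) (in_rank_sums p * F) =
  in_rank_sums (keep (fun e => T (shifted_energy lam e)) p) * F.
Proof.
move=> FP; rewrite {1}/in_rank_sums aevalE mulr_suml linear_sum.
rewrite linear_sum mulr_suml [RHS]big_mkcond; apply: eq_bigr => e _.
rewrite -/(in_rank_sums _) -scalerAl linearZ linearZ /= -scalerAl.
have EP := has_shapeM (@in_rank_sumsX_shape e) FP.
case: ifPn => Te; first by rewrite keep_all // => m /EP mE; rewrite /energy mE.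
by rewrite keep_none ?scaler0 // => m /EP mE; rewrite /energy mE.
Qed.

Lemma shape_homogeneous_lift (f : kSd P k) : shape_homogeneous f ->
  exists lam F, [/\ has_shape lam F, toSd F = f & toD F = garsia f].
Proof.
move=> [lam [N [c [m [mP ->]]]]]; exists lam, (\sum_(i < N) c i *: 'X_[m i]).
split.
- apply: has_shape_sum => i _; apply: has_shapeZ.
  by rewrite -(mP i).2; apply: has_shapeX.
- rewrite linear_sum; apply: eq_bigr => i _.
  by rewrite linearZ /= toSdE ymonE.
rewrite !linear_sum; apply: eq_bigr => i _.
by rewrite !linearZ /= toD_X garsia_standard // (mP i).1.
Qed.

End RankSums.

(** * Transfer of generation and of independence *)

Section Transfer.
Variables (d : Order.disp_t) (P : finBPOrderType d) (k : fieldType).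
Hypothesis hP : boolean_complex P.
Local Notation n := (rank_complex P).
Variables (r : nat) (F : 'I_r -> polySd P k) (lam : 'I_r -> {ffun 'I_n -> nat}).
Hypothesis FP : forall i, has_shape (lam i) (F i).
Implicit Types (p : 'I_r -> {mpoly k[n]}).

Definition combination p := \sum_i in_rank_sums (p i) * F i.

(** The coefficients of those products of a parameter monomial with an F_i whose
energy satisfies T. *)
Definition layer (T : pred nat) p i :=
  keep (fun e => T (shifted_energy (lam i) e)) (p i).

Lemma keep_combination (T : pred nat) p :
  keep (fun m => T (energy m)) (combination p) = combination (layer T p).
Proof.
by rewrite linear_sum; apply: eq_bigr => i _; apply: keep_energyM (@FP i).
Qed.

(** The coefficients vanish layer by layer from the top.  The bound q is on the
energies that the coefficients allow, not on those present in the combination: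
cancellation between different i may well remove the top layer of the
latter. *)
Lemma transfer_lin_indep :
  (forall p, toSd (combination p) = 0 -> forall i, p i = 0) ->
  forall p, toD (combination p) = 0 -> forall i, p i = 0.
Proof.
move=> indep p p0.
have main q : (forall i, {in msupp (p i), forall e,
    (shifted_energy (lam i) e < q)%N}) -> forall i, p i = 0.
  elim: q => [|q IH] pq.
    move=> i; apply: msuppnil0; case: (msupp (p i)) (pq i) => // e s /(_ e).
    by rewrite mem_head => /(_ isT).
  have top : {in msupp (combination p), forall m, (energy m <= q)%N}.
    move=> m mp; rewrite leqNgt; apply/negP => qm.
    have high0 : combination (layer (fun x => (q < x)%N) p) = 0.
      rewrite /combination big1 // => i _.
      rewrite /layer keep_none ?rmorph0 ?mul0r // => e ep.
      by rewrite -leqNgt -ltnS; apply: pq ep.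
    have := congr1 (mcoeff m) (keep_combination (fun x => (q < x)%N) p).
    by rewrite mcoeff_keep qm high0 mcoeff0 => /eqP; rewrite mcoeff_eq0 mp.
  have : toSd (combination (layer (pred1 q) p)) = 0.
    rewrite -keep_combination -toSd_keep.
    rewrite [X in toSd X](_ : _ = 0) ?rmorph0 //; apply/mpolyP => m.
    rewrite !mcoeff_keep mcoeff0; case: ifP => // stm; case: ifP => // /eqP mq.
    exact: leading_standard_eq0 p0 top _ stm mq.
  move=> /indep layer0; apply: IH => i e ep.
  have := pq i e ep; rewrite ltnS leq_eqVlt => /predU1P[eq|//].
  have := congr1 (mcoeff e) (layer0 i).
  rewrite mcoeff_keep /= eq eqxx mcoeff0 => /eqP.
  by rewrite mcoeff_eq0 ep.
apply: (main (\max_i \max_(e <- msupp (p i)) shifted_energy (lam i) e)%N.+1).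
move=> i e ep; rewrite ltnS.
apply: leq_trans (@leq_bigmax _
  (fun i => \max_(e <- msupp (p i)) shifted_energy (lam i) e)%N i).
exact: leq_bigmax_seq.
Qed.

(** Induction on the energy of a monomial of k[Delta], the nonstandard monomials
of a given energy being treated before the standard ones. *)
Lemma transfer_generates :
  (forall x, exists p, x = toSd (combination p)) ->
  forall x, exists p, x = toD (combination p).
Proof.
move=> gen.
pose M x := exists p, x = toD (combination p).
have MD x y : M x -> M y -> M (x + y).
  move=> [p ->] [p' ->]; exists (fun i => p i + p' i).
  rewrite -linearD -big_split; congr toD; apply: eq_bigr => i _.
  by rewrite linearD mulrDl.
have MZ c x : M x -> M (c *: x).
  move=> [p ->]; exists (fun i => c *: p i).
  rewrite -linearZ /= scaler_sumr; congr toD; apply: eq_bigr => i _.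
  by rewrite linearZ scalerAl.
have M0 : M 0.
  exists (fun=> 0); rewrite /combination big1 ?rmorph0 // => i _.
  by rewrite mul0r.
have main q m : (energy m < q)%N -> M (xmon k m).
  elim: q m => // q IH m; rewrite ltnS => mq.
  have nonstd m' : (energy m' <= q)%N -> ~~ standard m' -> M (xmon k m').
    move=> m'q /(xmon_straighten k hP)[s [sP ->]].
    rewrite big_seq; apply: (big_ind M) => // m'' /sP lt.
    exact: IH (leq_trans lt m'q).
  have [stm|] := boolP (standard m); last exact: nonstd.
  have [p] := gen (toSd 'X_[m]); move=> /eqP.
  rewrite -subr_eq0 -linearB /= => /eqP /(toSd_eq0_standard hP) std0.
  (* D dies in k[Sd Delta], so it has no standard part; its layer of the energy
     of m is the error of the transferred identity. *)
  have := keep_combination (pred1 (energy m)) p.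
  set D := 'X_[m] - combination p in std0 *.
  rewrite (_ : combination p = 'X_[m] - D); last by rewrite opprB addrC subrK.
  rewrite linearB /= keep_all => [|m']; last first.
    by rewrite msuppX inE => /eqP ->; apply: eqxx.
  move=> /eqP; rewrite subr_eq => /eqP e.
  rewrite -toD_X e linearD /=; apply: (MD).
    by exists (layer (pred1 (energy m)) p).
  rewrite linear_sum; apply: (big_ind M) => // m' /eqP m'E.
  rewrite linearZ /= toD_X.
  have [stm'|nst] := boolP (standard m'); last by apply/MZ/nonstd; rewrite ?m'E.
  have := congr1 (mcoeff m') std0; rewrite mcoeff_keep stm' mcoeff0 => ->.
  by rewrite scale0r.
move=> x; have [q <-] := toD_surj x; rewrite /toD aevalE.
apply: (big_ind M) => // m _; apply: MZ; rewrite -/(toD _) toD_X.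
exact: main (ltnSn _).
Qed.

End Transfer.

Theorem theorem3p27 (d : Order.disp_t) (P : finBPOrderType d) (k : fieldType)
    (hP : boolean_complex P) (r : nat) (f : 'I_r -> kSd P k)
    (hf : forall i, shape_homogeneous (f i)) :
  (generates (kGamma P k) f ->
     generates (kTheta P k) (fun i => garsia (f i))) /\
  (lin_indep (kGamma P k) f ->
     lin_indep (kTheta P k) (fun i => garsia (f i))).
Proof.
have [lam /choice[F FP]] := choice (fun i => shape_homogeneous_lift (hf i)).
have Fshape i : has_shape (lam i) (F i) by case: (FP i).
have toSdC p : toSd (combination F p) =
    \sum_i aeval (fun i : 'I__ => gamma P k i.+1) (p i) * f i.
  rewrite linear_sum; apply: eq_bigr => i _.
  by rewrite rmorphM /= toSd_rank_sums; case: (FP i) => _ ->.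
have toDC p : toD (combination F p) =
    \sum_i aeval (fun i : 'I__ => theta P k i.+1) (p i) * garsia (f i).
  rewrite linear_sum; apply: eq_bigr => i _.
  by rewrite rmorphM /= toD_rank_sums; case: (FP i) => _ _ ->.
split=> [gen x|indep a /choice[p aE] a0 i].
  have [y|p ->] := transfer_generates hP Fshape _ x.
    have [a [/choice[p aE] ->]] := gen y; exists p.
    by rewrite toSdC; apply: eq_bigr => i _; rewrite aE.
  exists (fun i => aeval (fun i : 'I__ => theta P k i.+1) (p i)).
  by split=> [i|]; [exists (p i) | rewrite toDC].
rewrite aE (_ : p i = 0) ?mmap0 //; move: i.
apply: (transfer_lin_indep hP Fshape) => [q|].
  rewrite toSdC => q0 i; apply: (gamma_algebraically_independent hP).
  rewrite toSd_rank_sums; move: i; apply: indep q0 => i.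
  by exists (q i).
by rewrite toDC -[RHS]a0; apply: eq_bigr => i _; rewrite aE.
Qed.
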